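(* Let $Z$ be a non-degenerate max-stable random variable (i.e. $Z$ arises as a non-degenerate limit in distribution of $a_n\max\{X_1,\dots,X_n\}-b_n$ for some i.i.d. sequence $X_1,X_2,\dots$ and constants $a_n>0$, $b_n\in\mathbb{R}$). Then $Z\in\mathcal{D}^-$ if and only if $Z$ is, up to a transformation $z\mapsto az+b$ with $a>0$, $b\in\mathbb{R}$, a Fréchet distribution with distribution function $F(x)=e^{-x^{-\alpha}}$, $x>0$, with parameter $0<\alpha\le1$.
   Context: For real random variables, $X \le_{st} Y$ means $P(X\le t)\ge P(Y\le t)$ for all $t\in\mathbb{R}$. A real random variable $X$ (equivalently its distribution function $F_X$) belongs to $\mathcal{D}^-$ if for every $n\in\mathbb{N}$, all $\theta_1,\dots,\theta_n\ge 0$ with $\sum_{i=1}^n\theta_i=1$, and i.i.d. random variables $X_1,\dots,X_n$ with distribution $F_X$, we have $X_1\le_{st}\sum_{i=1}^n\theta_iX_i$. *)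

(* Defs.v *)
From HB Require Import structures.
From mathcomp Require Import all_boot all_order all_algebra.
From mathcomp Require Import all_classical all_reals all_analysis.
Set Implicit Arguments. Unset Strict Implicit. Unset Printing Implicit Defensive.
Import Order.TTheory GRing.Theory Num.Theory.
Import numFieldNormedType.Exports.
Local Open Scope classical_set_scope.
Local Open Scope ring_scope.

Definition distfun (R : realType) (d : measure_display) (T : measurableType d)
  (P : probability T R) (X : T -> R) : R -> R :=
  fun t => fine (P [set w | X w <= t]).

Definition mutually_indep (R : realType) (d : measure_display) (T : measurableType d)
  (P : probability T R) (n : nat) (X : 'I_n -> T -> R) : Prop :=
  forall B : 'I_n -> set R, (forall i, measurable (B i)) ->
    P (\bigcap_(i in [set: 'I_n]) (X i @^-1` B i))
    = (\prod_(i < n) P (X i @^-1` B i))%E.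

Definition iid_fin (R : realType) (d : measure_display) (T : measurableType d)
  (P : probability T R) (n : nat) (X : 'I_n -> T -> R) (F : R -> R) : Prop :=
  (forall i, measurable_fun setT (X i)) /\ mutually_indep P X /\
  (forall i, distfun P (X i) = F).

Definition iid_seq (R : realType) (d : measure_display) (T : measurableType d)
  (P : probability T R) (X : nat -> T -> R) : Prop :=
  (forall i, measurable_fun setT (X i)) /\
  (forall n, mutually_indep P (fun i : 'I_n => X (val i))) /\
  (forall i, distfun P (X i) = distfun P (X 0%N)).

Definition st_le (R : realType) (d : measure_display) (T : measurableType d)
  (P : probability T R) (X Y : T -> R) : Prop :=
  forall t : R, distfun P Y t <= distfun P X t.

Definition in_Dminus (R : realType) (F : R -> R) : Prop :=
  forall (n : nat) (theta : 'I_n.+1 -> R),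
    (forall i, 0 <= theta i) -> \sum_(i < n.+1) theta i = 1 ->
    forall (d : measure_display) (T : measurableType d) (P : probability T R)
           (X : 'I_n.+1 -> T -> R),
      iid_fin P X F ->
      st_le P (X ord0) (fun w => \sum_(i < n.+1) theta i * X i w).

Definition cvg_in_dist (R : realType) (d' : measure_display) (T' : measurableType d')
  (P' : probability T' R) (Y : nat -> T' -> R)
  (d : measure_display) (T : measurableType d) (P : probability T R) (Z : T -> R) : Prop :=
  forall t : R, {for t, continuous (distfun P Z)} ->
    (fun n => distfun P' (Y n) t) @ \oo --> distfun P Z t.

Definition degenerate (R : realType) (d : measure_display) (T : measurableType d)
  (P : probability T R) (Z : T -> R) : Prop :=
  exists c : R, forall t, distfun P Z t = (if c <= t then 1 else 0).

Definition max_first (R : realType) (T : Type) (X : nat -> T -> R) (n : nat) : T -> R :=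
  fun w => \big[Num.max/X 0%N w]_(i < n.+1) X i w.

Definition max_stable (R : realType) (d : measure_display) (T : measurableType d)
  (P : probability T R) (Z : T -> R) : Prop :=
  measurable_fun setT Z /\ ~ degenerate P Z /\
  exists (d' : measure_display) (T' : measurableType d') (P' : probability T' R)
         (X : nat -> T' -> R) (a b : nat -> R),
    iid_seq P' X /\ (forall n, 0 < a n) /\
    cvg_in_dist P' (fun n w => a n * max_first X n w - b n) P Z.

Definition frechet (R : realType) (alpha : R) (x : R) : R :=
  if 0 < x then expR (- (x `^ (- alpha))) else 0.

(* Main.v *)
(* If Z is Frechet with alpha <= 1 and lower endpoint 0, a weighted sum of copies
   of Z dominates max_i theta_i X_i, which is Frechet with scale factor
   sum_i theta_i^alpha >= 1.

   Conversely, convergence of types shows that for each k >= 1 the distribution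
   function G of Z satisfies G(p t + q)^k = G(t) for some p > 0 and q, so the law
   belongs to one of three families according to whether p < 1, p = 1 or p > 1
   for k = 2. The tail 1 - G then decays along the iterates of the affine map
   like a power of 2, while membership in D^- with weights (1/2, 1/2) forces
   1 - G(t) <= 2 (1 - G(v)) + (1 - G(s))^2 whenever s <= v and t = (s + v) / 2.
   This excludes p < 1 (Weibull) and p = 1 (Gumbel). If p > 1, all the affine
   maps fix the lower endpoint c, and the resulting scaling relations make
   - ln G(c + t) a multiple of t^-alpha; the same inequality gives
   alpha <= 1. *)
Require Import Defs.
From HB Require Import structures.
From mathcomp Require Import all_boot all_order all_algebra.
From mathcomp Require Import all_classical all_reals all_analysis.
From mathcomp Require Import measurable_realfun ring lra.
Set Implicit Arguments. Unset Strict Implicit. Unset Printing Implicit Defensive.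
Import Order.TTheory GRing.Theory Num.Theory.
Import numFieldNormedType.Exports.
Local Open Scope classical_set_scope.
Local Open Scope ring_scope.

(** * Continuity points and distribution functions *)

(** A monotone function has only countably many discontinuities in []a, b[]; if every point were
    one, the interval would be countable and hence Lebesgue-null. *)
Lemma continuity_point_dense (R : realType) (G : R -> R) (a b : R) :
  {homo G : x y / x <= y} -> a < b ->
  exists2 c, a < c < b & {for c, continuous G}.
Proof.
move=> ndG ab; apply: contrapT => nocont.
have cn := @discontinuity_countable R a b G (fun x y _ _ => @ndG x y).
have sub : `]a, b[%classic `<=` [set x | x \in (`]a, b[) /\ discontinuity G x].
  move=> x xab; split; first by rewrite /= in xab *.
  have [ax xb] : a < x /\ x < b by move: xab; rewrite /= in_itv/= => /andP.
  have cl : cvg (G y @[y --> x^'-]).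
    apply: nondecreasing_at_left_is_cvgr.
      by near=> y => u v _ _; exact: ndG.
    by near=> y; exists (G x) => _ [u + <-]; rewrite /= in_itv/= => /andP[_ /ltW /ndG].
  have cr : cvg (G y @[y --> x^'+]).
    apply: nondecreasing_at_right_is_cvgr.
      by near=> y => u v _ _; exact: ndG.
    by near=> y; exists (G x) => _ [u + <-]; rewrite /= in_itv/= => /andP[/ltW /ndG].
  split=> //; apply/eqP => lr; apply: nocont; exists x; first by rewrite ax xb.
  have lx : lim (G y @[y --> x^'-]) <= G x.
    by apply: limr_le => //; near=> y; apply: ndG; rewrite ltW.
  have xr : G x <= lim (G y @[y --> x^'+]).
    by apply: limr_ge => //; near=> y; apply: ndG; rewrite ltW.
  apply/left_right_continuousP; split.
    by have -> : G x = lim (G y @[y --> x^'-]) by apply/eqP; rewrite eq_le lx lr xr.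
  by have -> : G x = lim (G y @[y --> x^'+]) by apply/eqP; rewrite eq_le xr -lr lx.
have /countable_lebesgue_measure0 : countable `]a, b[%classic.
  exact: sub_countable (subset_card_le sub) cn.
rewrite lebesgue_measure_itv/= lte_fin ab => /eqP.
by rewrite -EFinB eqe subr_eq0 => /eqP ba; rewrite ba ltxx in ab.
Unshelve. all: by end_near. Qed.

(* Right-continuity and the limits at infinity are stated by inequalities, which
   is how they get used. *)
Definition is_df (R : realType) (G : R -> R) :=
  [/\ forall x, 0 <= G x <= 1, {homo G : x y / x <= y},
      forall x c : R, (forall y, x < y -> c <= G y) -> c <= G x,
      forall e : R, 0 < e -> exists x, G x < e
    & forall e : R, e < 1 -> exists x, e < G x].

Lemma distfun_is_df (R : realType) (d : measure_display) (T : measurableType d)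
    (P : probability T R) (Z : T -> R) :
  measurable_fun setT Z -> is_df (distfun P Z).
Proof.
move=> mZ; pose X : {RV P >-> R} := mfun_Sub (mem_set mZ).
have GE t : distfun P Z t = fine (cdf X t).
  by rewrite /distfun /cdf /distribution /pushforward/=; congr (fine (P _));
    apply/seteqP; split => w; rewrite /= in_itv.
have fG t : cdf X t \is a fin_num by rewrite fin_num_measure.
have GE' t : cdf X t = (distfun P Z t)%:E by rewrite GE fineK.
split.
- move=> x; rewrite -!lee_fin -GE'; rewrite cdf_ge0 cdf_le1//.
- by move=> x y xy; rewrite -lee_fin -!GE'; exact: cdf_nondecreasing.
- move=> x c H; rewrite -lee_fin -GE'.
  have cv := @cdf_right_continuous _ _ _ P X x.
  apply: (cvge_ge _ cv).
  near=> y; rewrite GE' lee_fin; apply: H.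
  by near: y; exact: nbhs_right_gt.
- move=> e e0.
  have /fine_cvgP[_ /cvgrPdist_lt /(_ e e0)] := @cvg_cdfNy0 _ _ _ P X.
  move=> H; near (ninfty_nbhs R) => x.
  have : `|0 - fine (cdf X x)| < e by near: x.
  rewrite -GE sub0r normrN => He; exists x.
  by apply: le_lt_trans He; rewrite ler_norm.
- move=> e e1; have e0 : 0 < 1 - e by rewrite subr_gt0.
  have /fine_cvgP[_ /cvgrPdist_lt /(_ _ e0)] := @cvg_cdfy1 _ _ _ P X.
  move=> H; near (pinfty_nbhs R) => x.
  have : `|1 - fine (cdf X x)| < 1 - e by near: x.
  rewrite -GE => He; exists x.
  by have := le_lt_trans (ler_norm _) He; lra.
Unshelve. all: by end_near. Qed.

(** A distribution function with values only 0 and 1 jumps at the infimum of its positivity set, and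
    right-continuity makes the law a point mass there. *)
Lemma nondegenerate_value (R : realType) (d : measure_display)
    (T : measurableType d) (P : probability T R) (Z : T -> R) :
  measurable_fun setT Z -> ~ degenerate P Z ->
  exists t, 0 < distfun P Z t < 1.
Proof.
move=> mZ nd; have [G01 ndG rcG G0 G1] := distfun_is_df P mZ.
set G := distfun P Z in G01 ndG rcG G0 G1 *.
apply: contrapT => H; apply: nd.
have GV t : 0 < G t -> G t = 1.
  move=> t0; apply/eqP; rewrite eq_le; case/andP: (G01 t) => _ -> /=.
  by rewrite leNgt; apply/negP => t1; apply: H; exists t; rewrite t0.
have [x1 x1P] := G1 0 ltr01; have [x0 x0P] := G0 1 ltr01.
pose A := [set t | 0 < G t].
have hA : has_inf A.
  split; first by exists x1.
  exists x0 => t At; rewrite leNgt; apply/negP => tx.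
  by have := ndG _ _ (ltW tx); rewrite (GV _ At) leNgt x0P.
exists (inf A) => t; case: leP => ct; last first.
  apply/eqP; rewrite eq_le; case/andP: (G01 t) => -> _; rewrite andbT leNgt.
  by apply/negP => /(ge_inf hA.2); rewrite leNgt ct.
apply/eqP; rewrite eq_le; case/andP: (G01 t) => _ -> /=.
apply: rcG => y ty.
have [z Az zy] := @inf_adherent R A (y - inf A) ltac:(lra) hA.
by rewrite -(GV _ Az); apply: ndG; lra.
Qed.

(** * Elementary estimates and the midpoint inequality *)

Lemma expr_lt_small (R : realType) (z e : R) :
  0 <= z < 1 -> 0 < e -> exists n, z ^+ n < e.
Proof.
move=> /andP[z0 z1] e0.
have /cvgrPdist_lt /(_ e e0) [n _ /(_ n (leqnn n))] :
  (z ^+ n @[n --> \oo] --> (0 : R)) by apply: cvg_expr; rewrite ger0_norm.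
by rewrite sub0r normrN ger0_norm ?exprn_ge0// => zn; exists n.
Qed.

(** If [u < w], a fraction [m / n] fits between them: [n] exceeds the inverse of the gap and [m] is
    the first integer above [n * u], so it is positive. *)
Lemma nat_ratio_le (R : realType) (u w : R) : 0 <= u ->
  (forall n m : nat, (0 < m)%N -> n%:R * u <= m%:R -> n%:R * w <= m%:R) ->
  w <= u.
Proof.
move=> u0 H; rewrite leNgt; apply/negP => uw.
have d0 : 0 < w - u by rewrite subr_gt0.
pose n := (Num.truncn (w - u)^-1).+1; pose m := (Num.truncn (n%:R * u)).+1.
have n1 : 1 < n%:R * (w - u).
  by rewrite -ltr_pdivrMr// div1r; exact: truncnS_gt.
have um : n%:R * u <= m%:R by rewrite ltW// truncnS_gt.
have mu : m%:R <= n%:R * u + 1.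
  by rewrite /m -natr1 lerD2r truncn_le// mulr_ge0.
have := H n m isT um; rewrite mulrBr in n1; lra.
Qed.

Lemma nat_ratio_eq (R : realType) (u w : R) : 0 <= u -> 0 <= w ->
  (forall n m : nat, (0 < n)%N -> (0 < m)%N ->
    n%:R * u <= m%:R -> n%:R * w <= m%:R) ->
  (forall n m : nat, (0 < n)%N -> (0 < m)%N ->
    m%:R <= n%:R * u -> m%:R <= n%:R * w) ->
  u = w.
Proof.
move=> u0 w0 H1 H2; apply/eqP; rewrite eq_le; apply/andP; split; last first.
  apply: nat_ratio_le => // -[|n] m m0; last exact: H1.
  by rewrite !mul0r.
rewrite leNgt; apply/negP => wu.
have d0 : 0 < u - w by rewrite subr_gt0.
pose n := (Num.truncn (u - w)^-1).+1; pose m := (Num.truncn (n%:R * w)).+1.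
have n1 : 1 < n%:R * (u - w).
  by rewrite -ltr_pdivrMr// div1r; exact: truncnS_gt.
have um : n%:R * w < m%:R by rewrite truncnS_gt.
have mu : m%:R <= n%:R * w + 1.
  by rewrite /m -natr1 lerD2r truncn_le// mulr_ge0.
have := H2 n m isT isT; rewrite mulrBr in n1; lra.
Qed.

Lemma expRN_bounds (R : realType) (x : R) : 0 <= x ->
  1 - x <= expR (- x) <= 1 - x + x ^+ 2.
Proof.
move=> x0; apply/andP; split; first exact: expR_ge1Dx.
have e1 := expR_ge1Dx x; have e2 := expR_gt0 x.
rewrite expRN -div1r ler_pdivrMr//.
have y0 : 0 <= 1 - x + x ^+ 2 by nra.
have x3 : 0 <= x ^+ 3 by exact: exprn_ge0.
apply: (@le_trans _ _ ((1 - x + x ^+ 2) * (1 + x))); last exact: ler_wpM2l.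
have -> : (1 - x + x ^+ 2) * (1 + x) = 1 + x ^+ 3 by ring.
lra.
Qed.

(* The case [theta = (1/2, 1/2)] of membership in D^-: for independent X_1, X_2
   with distribution [G], the left side is the probability that both are at most
   [v] and one of them is at most [s]. *)
Definition midpoint_bound (R : realType) (G : R -> R) :=
  forall s v, s <= v -> G s * (2 * G v - G s) <= G ((s + v) / 2).

(** With [x = G s] and [y = G v], the identity 1 - x(2y - x) = (1 - x)^2 + 2x(1 - y) makes the cost
    of [s] quadratic and that of [v] linear. Bounding [1 - expR (- ht)] below by [ht - ht ^+ 2] then
    gives an inequality between exponents. *)
Lemma midpoint_bound_exp (R : realType) (G : R -> R) (s v hs hv ht : R) :
  midpoint_bound G -> s <= v -> 0 <= hs -> 0 <= hv -> 0 <= ht ->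
  G s = expR (- hs) -> G v = expR (- hv) -> G ((s + v) / 2) <= expR (- ht) ->
  ht - ht ^+ 2 <= 2 * hv + hs ^+ 2.
Proof.
move=> mG sv hs0 hv0 ht0 Gs Gv Gt.
have := le_trans (mG _ _ sv) Gt; rewrite Gs Gv.
have x1 : expR (- hs) <= 1 by rewrite expR_le1 oppr_le0.
have y1 : expR (- hv) <= 1 by rewrite expR_le1 oppr_le0.
have x0 := expR_gt0 (- hs).
move/expRN_bounds : hs0 => /andP[xb _]; move/expRN_bounds : hv0 => /andP[yb _].
move/expRN_bounds : ht0 => /andP[_ zb].
move: (expR (- hs)) (expR (- hv)) (expR (- ht)) x1 y1 x0 xb yb zb.
move=> x y z x1 y1 x0 xb yb zb xyz.
have : (1 - x) ^+ 2 <= hs ^+ 2 by nra.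
have : x * (1 - y) <= hv by nra.
nra.
Qed.

Lemma sqr_eq_expR (R : realType) (g h : R) :
  0 <= g -> g ^+ 2 = expR (- h) -> g = expR (- (h / 2)).
Proof.
move=> g0 gh; apply/(pexpIrn (n := 2)); rewrite ?nnegrE ?expR_ge0//.
by rewrite gh expr2 -expRD; congr expR; lra.
Qed.

(** * Excluding the Gumbel and Weibull types *)

Lemma not_translation_stable (R : realType) (G : R -> R) (q t0 : R) :
  is_df G -> 0 < G t0 < 1 -> midpoint_bound G ->
  ~ (forall t, G (t + q) ^+ 2 = G t).
Proof.
move=> [G01 ndG _ _ _] /andP[g0 g1] mG st.
have [h h0 Gh] : exists2 h : R, 0 < h & G t0 = expR (- h).
  by exists (- ln (G t0)); rewrite ?oppr_gt0 ?ln_lt0 ?g0// opprK lnK.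
have Gq m : G (t0 + m%:R * q) = expR (- (h / 2 ^+ m)).
  elim: m => [|m IH]; first by rewrite mul0r addr0 expr0 divr1.
  have := st (t0 + m%:R * q); rewrite IH => /sqr_eq_expR.
  have -> : t0 + m.+1%:R * q = t0 + m%:R * q + q by rewrite -natr1; ring.
  move=> ->; first by rewrite exprSr invfM mulrA.
  by case/andP: (G01 (t0 + m%:R * q + q)).
have q0 : 0 <= q.
  rewrite leNgt; apply/negP => qn.
  have /ndG : t0 + 1%:R * q <= t0 by lra.
  rewrite Gq Gh ler_expR; lra.
(* The indices [3 * i] and [5 * i] have mean [4 * i]. With x = 2^-i the midpoint inequality, divided
   by h x^4, reads 1 <= x (2 + h x + h x^3), which fails once x < 1 / (2 + 2h). *)
have c0 : 0 < (2 + 2 * h)^-1 by rewrite invr_gt0; lra.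
have [i ih] := expr_lt_small (R := R) (z := 2^-1) ltac:(lra) c0.
have x0 : 0 < (2 : R)^-1 ^+ i by rewrite exprn_gt0.
have := @midpoint_bound_exp R G (t0 + (3 * i)%:R * q) (t0 + (5 * i)%:R * q)
  (h / 2 ^+ (3 * i)) (h / 2 ^+ (5 * i)) (h / 2 ^+ (4 * i)) mG.
rewrite !Gq !divr_ge0 ?(ltW h0) ?exprn_ge0//.
have -> : (t0 + (3 * i)%:R * q + (t0 + (5 * i)%:R * q)) / 2
   = t0 + (4 * i)%:R * q by rewrite !natrM; field.
rewrite Gq -!exprVn !(mulnC _ i) !exprM.
move: (2^-1 ^+ i) ih x0 => x ih x0 /(_ _ isT isT isT erefl erefl (lexx _)) H.
have x1 : x * (2 + 2 * h) < 1 by rewrite -ltr_pdivlMr ?div1r//; lra.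
have {}H : h * x ^+ 4 - (h * x ^+ 4) ^+ 2 <=
    2 * (h * x ^+ 5) + (h * x ^+ 3) ^+ 2.
  by apply: H; rewrite lerD2l ler_wpM2r// ler_nat leq_mul2l orbT.
have H2 : (h * x ^+ 4) * (x * (2 + h * x + h * x ^+ 3)) >= h * x ^+ 4 by lra.
have hx : 0 < h * x ^+ 4 by rewrite mulr_gt0// exprn_gt0.
have : 1 <= x * (2 + h * x + h * x ^+ 3) by rewrite -(ler_pM2l hx) mulr1.
apply/negP; rewrite -ltNge; apply: (le_lt_trans _ x1).
have xle1 : x <= 1 by have := mulr_gt0 x0 h0; lra.
have x31 : x ^+ 3 <= 1 by rewrite exprn_ile1// ltW.
apply: ler_wpM2l; first exact: ltW.
nra.
Qed.

Lemma dilation_iter (R : realType) (G : R -> R) (c p t h : R) (m : nat) :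
  (forall x, 0 <= G x) -> (forall t, G (c + p * (t - c)) ^+ 2 = G t) ->
  G t = expR (- h) -> G (c + p ^+ m * (t - c)) = expR (- (h / 2 ^+ m)).
Proof.
move=> G0 st Gt; elim: m => [|m IH]; first by rewrite expr0 mul1r addrC subrK divr1.
have := st (c + p ^+ m * (t - c)); rewrite IH => /sqr_eq_expR.
have -> : c + p * (c + p ^+ m * (t - c) - c) = c + p ^+ m.+1 * (t - c).
  by rewrite exprS; ring.
by move=> -> //; rewrite exprSr invfM mulrA.
Qed.

(** Here [c] is an upper endpoint with [G c = 1], so taking [v = c] removes the linear term on the
    right of the midpoint inequality and leaves only a quadratic one. *)
Lemma not_contraction_stable (R : realType) (G : R -> R) (c p t0 : R) :
  is_df G -> 0 < G t0 < 1 -> midpoint_bound G -> 0 < p < 1 ->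
  ~ (forall t, G (c + p * (t - c)) ^+ 2 = G t).
Proof.
move=> [G01 ndG _ _ _] /andP[g0 g1] mG /andP[p0 p1] st.
have G0 x : 0 <= G x by case/andP: (G01 x).
have G1 x : G x <= 1 by case/andP: (G01 x).
(* If [c <= t0], the contraction moves [t0] to the left, so the value x there satisfies x <= G t0 =
   x^2, which is incompatible with [0 < G t0 < 1]. *)
have t0c : t0 < c.
  rewrite ltNge; apply/negP => ct.
  have /ndG : c + p * (t0 - c) <= t0 by nra.
  have := st t0; have := G0 (c + p * (t0 - c)); move: (G _) => x x0 E; nra.
have Gc : G c = expR (- 0).
  rewrite oppr0 expR0; have := st c; rewrite subrr mulr0 addr0 => E.
  have := ndG _ _ (ltW t0c); move: E; move: (G c) => x E xt.
  have : x * (x - 1) = 0 by lra.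
  by move/eqP; rewrite mulf_eq0 => /orP[] /eqP; lra.
have [h h0 Gh] : exists2 h : R, 0 < h & G t0 = expR (- h).
  by exists (- ln (G t0)); rewrite ?oppr_gt0 ?ln_lt0 ?g0// opprK lnK.
have Gm m := dilation_iter m G0 st Gh.
(* Since [p ^+ l < 1/2], the midpoint of [c + p ^+ j * (t0 - c)] and [c] lies below the iterate of
   index [l + j]. With z = 2^-l and y = 2^-j the inequality becomes z <= h y (1 + z^2) <= 2 h y, and
   [j] is chosen to make 2 h y < z. *)
have [l lP] := expr_lt_small (z := p) (e := 2^-1) ltac:(lra) ltac:(lra).
have z0 : 0 < (2 : R)^-1 ^+ l by rewrite exprn_gt0.
have d0 : 0 < (2 : R)^-1 ^+ l / (2 * h) by rewrite divr_gt0// mulr_gt0.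
have [j jP] := expr_lt_small (R := R) (z := 2^-1) ltac:(lra) d0.
have y0 : 0 < (2 : R)^-1 ^+ j by rewrite exprn_gt0.
have pj0 : 0 < p ^+ j by rewrite exprn_gt0.
have := @midpoint_bound_exp R G (c + p ^+ j * (t0 - c)) c
  (h / 2 ^+ j) 0 (h / 2 ^+ (l + j)) mG.
rewrite !Gm Gc !divr_ge0 ?(ltW h0) ?exprn_ge0//.
have ht : G ((c + p ^+ j * (t0 - c) + c) / 2) <= expR (- (h / 2 ^+ (l + j))).
  rewrite -Gm; apply: ndG; rewrite exprD -subr_ge0.
  have -> : c + p ^+ l * p ^+ j * (t0 - c) - (c + p ^+ j * (t0 - c) + c) / 2 =
    (2^-1 - p ^+ l) * (p ^+ j * (c - t0)) by field.
  by rewrite !mulr_ge0// ?subr_ge0 ltW.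
move=> /(_ _ isT (lexx _) isT erefl erefl ht).
have sc : c + p ^+ j * (t0 - c) <= c by nra.
move=> /(_ sc); rewrite exprD invfM -!exprVn => H.
have z1 : (2 : R)^-1 ^+ l <= 1 by rewrite exprn_ile1//; lra.
move: ((2 : R)^-1 ^+ l) ((2 : R)^-1 ^+ j) z0 z1 d0 y0 jP H => z y z0 z1 d0 y0.
rewrite ltr_pdivlMr; last by rewrite mulr_gt0.
move=> jP H.
have : h * y * z <= h * y * (h * y * (1 + z ^+ 2)) by lra.
rewrite ler_pM2l ?mulr_gt0// => zz.
have : h * y * (1 + z ^+ 2) <= h * y * 2 by rewrite ler_pM2l ?mulr_gt0//; nra.
lra.
Qed.

(** * Scaling relations and the Fréchet form *)

(** The factor for [k = 2] fixes the exponent; monotonicity forces every other factor to agree with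
    it, and then carries the law from integer multiples to all positive reals. *)
Lemma power_law_of_scaling (R : realType) (H : R -> R) :
  (forall t, 0 < t -> 0 < H t) -> (forall s t, 0 < s -> s <= t -> H t <= H s) ->
  (forall k, (0 < k)%N ->
    exists2 p, 0 < p & forall t, 0 < t -> H (p * t) = H t / k%:R) ->
  exists a h, [/\ 0 < a, 0 < h & forall t, 0 < t -> H t = h * t `^ (- a)].
Proof.
move=> H0 niH sc.
have sc_iter k p m t : 0 < p -> (forall t, 0 < t -> H (p * t) = H t / k%:R) ->
    0 < t -> H (p ^+ m * t) = H t / k%:R ^+ m.
  move=> p0 pH t0; elim: m => [|m IH]; first by rewrite !expr0 mul1r divr1.
  by rewrite exprS -mulrA pH ?mulr_gt0 ?exprn_gt0// IH exprSr invfM mulrA.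
have sc_gt1 k p : (1 < k)%N -> 0 < p ->
    (forall t, 0 < t -> H (p * t) = H t / k%:R) -> 1 < p.
  move=> k1 p0 pH; rewrite ltNge; apply/negP => p1.
  have := niH _ _ p0 p1; have := pH 1 ltr01; rewrite mulr1 => ->.
  apply/negP; rewrite -ltNge ltr_pdivrMr ?ltr0n ?(ltn_trans _ k1)//.
  by rewrite ltr_pMr ?ltr1n// H0.
have [p p0 pH] := sc 2%N isT; have p1 := sc_gt1 2%N p isT p0 pH.
have lp : 0 < ln p by rewrite ln_gt0.
have l2 : 0 < ln (2 : R) by rewrite ln_gt0// ltr1n.
pose a := ln 2 / ln p.
have a0 : 0 < a by rewrite divr_gt0.
have aN0 : a != 0 by rewrite gt_eqF.
have H1 := H0 1 ltr01.
have powk k : (0 < k)%N ->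
    forall t, 0 < t -> H (k%:R `^ a^-1 * t) = H t / k%:R.
  rewrite leq_eqVlt => /predU1P[<- t t0|k1]; first by rewrite powR1 mul1r divr1.
  have k0 := ltnW k1.
  have [r r0 rH] := sc k k0; have r1 := sc_gt1 k r k1 r0 rH.
  suff -> : k%:R `^ a^-1 = r by [].
  have kp : 0 < k%:R :> R by rewrite ltr0n.
  have lr : 0 < ln r by rewrite ln_gt0.
  have lk : 0 < ln (k%:R : R) by rewrite ln_gt0// ltr1n.
  (* Since H(r^n) = H(1) / k^n and H(p^m) = H(1) / 2^m, monotonicity transfers each comparison of
     r^n with p^m to k^n and 2^m, so both ratios of logarithms meet the same fractions in the same
     order. *)
  suff E : ln r / ln p = ln k%:R / ln 2.
    apply: ln_inj; rewrite ?posrE ?powR_gt0// ln_powR /a invf_div mulrAC.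
    rewrite -mulrA -E; field; exact: lt0r_neq0.
  have lnX x m : 0 < x -> m%:R * ln x = ln (x ^+ m) :> R.
    by move=> x0; rewrite lnXn// mulr_natl.
  have Hr m := sc_iter k r m 1 r0 rH ltr01.
  have Hp m := sc_iter 2%N p m 1 p0 pH ltr01.
  apply: nat_ratio_eq => [||n m n0 m0|n m n0 m0].
  - by rewrite divr_ge0// ltW.
  - by rewrite divr_ge0// ltW.
  - rewrite !mulrA !ler_pdivrMr// !lnX// !ler_ln ?posrE ?exprn_gt0// => rp.
    have := niH (r ^+ n * 1) (p ^+ m * 1); rewrite Hr Hp !mulr1 exprn_gt0// rp.
    move=> /(_ isT isT); rewrite ler_pM2l// lef_pV2 ?posrE ?exprn_gt0//.
  - rewrite !mulrA !ler_pdivlMr// !lnX// !ler_ln ?posrE ?exprn_gt0// => rp.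
    have := niH (p ^+ m * 1) (r ^+ n * 1); rewrite Hr Hp !mulr1 exprn_gt0// rp.
    move=> /(_ isT isT); rewrite ler_pM2l// lef_pV2 ?posrE ?exprn_gt0//.
(* This change of variable normalises the exponent to 1: all scaling relations become L(k y) = L(y)
   / k. *)
pose L y := H (y `^ a^-1).
have L0 y : 0 < y -> 0 < L y by move=> y0; apply: H0; rewrite powR_gt0.
have niL x y : 0 < x -> x <= y -> L y <= L x.
  move=> x0 xy; apply: niH; rewrite ?powR_gt0// ge0_ler_powR// ?nnegrE ?invr_ge0 ltW//.
  exact: lt_le_trans xy.
have Lk k y : (0 < k)%N -> 0 < y -> L (k%:R * y) = L y / k%:R.
  by move=> k0 y0; rewrite /L powRM ?ler0n ?(ltW y0)// powk// powR_gt0.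
have LE y : 0 < y -> L y = L 1 / y.
  move=> y0.
  (* Comparing [n * y] with [m] and applying the monotone [L] gives the same comparison for
     [L 1 / L y], because L(m) = L(1) / m. *)
  suff yE : y = L 1 / L y.
    by rewrite [in RHS]yE invf_div mulrCA divff ?mulr1// gt_eqF// L0.
  have Ly := L0 y y0; have L1 := L0 1 ltr01.
  have Lm m : (0 < m)%N -> L m%:R = L 1 / m%:R.
    by move=> m0; rewrite -[X in L X]mulr1 Lk.
  apply: nat_ratio_eq => [||n m n0 m0 nm|n m n0 m0 nm].
  - exact: ltW.
  - by rewrite divr_ge0// ltW.
  - rewrite mulrA ler_pdivrMr//.
    have nr0 : 0 < n%:R :> R by rewrite ltr0n.
    have := niL _ _ (mulr_gt0 nr0 y0) nm.
    rewrite Lm// Lk//.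
    rewrite ler_pdivrMr ?ltr0n// mulrAC ler_pdivlMr ?ltr0n//; lra.
  - rewrite mulrA ler_pdivlMr//.
    have mr0 : 0 < m%:R :> R by rewrite ltr0n.
    have := niL _ _ mr0 nm.
    rewrite Lm// Lk//.
    rewrite ler_pdivrMr ?ltr0n// mulrAC ler_pdivlMr ?ltr0n//; lra.
exists a, (L 1); split => //; first exact: L0.
move=> t t0; rewrite powRN -LE ?powR_gt0// /L -powRrM divff// powRr1// ltW//.
Qed.

(** For [a > 1] a single large value is too rare: far out, the linear terms of the midpoint
    inequality already contradict it. *)
Lemma tail_exponent_le1 (R : realType) (G : R -> R) (c a h : R) :
  midpoint_bound G -> 0 < a -> 0 < h ->
  (forall t, 0 < t -> G (c + t) = expR (- (h * t `^ (- a)))) -> a <= 1.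
Proof.
move=> mG a0 h0 GE; rewrite leNgt; apply/negP => a1.
have aN0 : a != 0 by rewrite gt_eqF.
pose r : R := 2 `^ a^-1.
have ra : r `^ a = 2 by rewrite /r -powRrM mulVf// powRr1.
have r0 : 0 < r by rewrite powR_gt0.
have r2 : r < 2.
  rewrite -ltr_ln ?posrE// /r ln_powR gtr_pMl ?invf_lt1//.
  by rewrite ln_gt0// ltr1n.
(* The points [s] and [e] have mean 1, and [e > 2^(1/a)] gives [A = 2 * e^(-a) < 1]. *)
pose e := (2 + r) / 2; pose s := 2 - e.
have [re e2] : r < e /\ e < 2 by rewrite /e; split; lra.
have e0 : 0 < e by exact: lt_trans re.
have s0 : 0 < s by rewrite /s; lra.
have se : s <= e by rewrite /s /e; lra.
pose A := 2 * e `^ (- a); pose B := s `^ (- a).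
have A1 : A < 1.
  rewrite /A powRN -[X in X * _]ra ltr_pdivrMr ?powR_gt0// mul1r.
  by rewrite gt0_ltr_powR// ?nnegrE ltW.
have B0 : 0 < B by rewrite powR_gt0.
have A0 : 0 < A by rewrite mulr_gt0// powR_gt0.
(* At the scale [T] where the exponent equals [y], the inequality reads 1 - A <= y (1 + B^2); this
   [y] makes the right side half of the left. *)
pose y := (1 - A) / (2 * (1 + B ^+ 2)).
have B2 : 0 < 1 + B ^+ 2 by have := sqr_ge0 B; lra.
have y0 : 0 < y by rewrite divr_gt0 ?subr_gt0// mulr_gt0.
pose T := (h / y) `^ a^-1.
have T0 : 0 < T by rewrite powR_gt0// divr_gt0.
have Ty : h * T `^ (- a) = y.
  rewrite powRN /T -powRrM mulVf// powRr1; last by rewrite divr_ge0// ltW.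
  by rewrite invf_div mulrCA divff ?mulr1// gt_eqF.
have scale x : 0 < x -> h * (x * T) `^ (- a) = x `^ (- a) * y.
  by move=> x0; rewrite powRM ?(ltW x0) ?(ltW T0)// mulrCA Ty.
have hE x : 0 < x -> G (c + x * T) = expR (- (x `^ (- a) * y)).
  by move=> x0; rewrite GE ?mulr_gt0// scale.
have sv : c + s * T <= c + e * T by rewrite lerD2l ler_wpM2r// ltW.
have mid : G ((c + s * T + (c + e * T)) / 2) <= expR (- y).
  have -> : (c + s * T + (c + e * T)) / 2 = c + T by rewrite /s; field.
  by rewrite GE// Ty.
have hs0 : 0 <= s `^ (- a) * y by rewrite mulr_ge0 ?powR_ge0// ltW.
have he0 : 0 <= e `^ (- a) * y by rewrite mulr_ge0 ?powR_ge0// ltW.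
have := midpoint_bound_exp mG sv hs0 he0 (ltW y0) (hE _ s0) (hE _ e0) mid.
rewrite -/B mulrA -/A => H.
have {}H : y * (1 - A) <= y * (y * (1 + B ^+ 2)) by lra.
move: H; rewrite ler_pM2l// /y invfM mulrA -mulrA mulVf ?gt_eqF// mulr1.
by lra.
Qed.

Lemma frechet_of_dilation_stable (R : realType) (G : R -> R) (c p2 t0 : R) :
  is_df G -> 0 < G t0 < 1 -> midpoint_bound G -> 1 < p2 ->
  (forall t, G (c + p2 * (t - c)) ^+ 2 = G t) ->
  (forall k, (0 < k)%N -> exists p q, 0 < p /\ forall t, G (p * t + q) ^+ k = G t) ->
  exists a b alpha : R, 0 < a /\ 0 < alpha <= 1 /\
    forall x, G x = frechet alpha ((x - b) / a).
Proof.
move=> [G01 ndG _ _ _] /andP[g0 g1] mG p1 st2 st.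
have G0 x : 0 <= G x by case/andP: (G01 x).
have G1 x : G x <= 1 by case/andP: (G01 x).
have iter m t : G (c + p2 ^+ m * (t - c)) ^+ (2 ^ m) = G t.
  elim: m => [|m IH]; first by rewrite expr0 expr1 mul1r addrC subrK.
  rewrite expnS exprM -[RHS]IH -[in RHS]st2.
  by congr ((G _) ^+ _ ^+ _); rewrite exprS; ring.
(* The expanding iterates of any point right of [c] pass every bound, so G lies strictly between 0
   and 1 on the whole half-line beyond [c]. *)
have escape s t : c < t -> exists m, s <= c + p2 ^+ m * (t - c).
  move=> ct.
  have [||m mP] := @expr_lt_small R p2^-1 ((t - c) / (1 + `|s - c|)).
  - by rewrite invr_ge0 (le_trans ler01 (ltW p1))// invf_lt1// (lt_trans ltr01).
  - by apply: divr_gt0; [rewrite subr_gt0|rewrite ltr_pwDl].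
  exists m; move: mP; rewrite exprVn.
  rewrite ltr_pdivlMr; last by rewrite ltr_pwDl.
  rewrite mulrC ltr_pdivrMr; last by rewrite exprn_gt0// (lt_trans ltr01).
  have := ler_norm (s - c); lra.
have ct0 : c < t0.
  rewrite ltNge; apply/negP => ct.
  have /ndG : c + p2 * (t0 - c) <= t0 by nra.
  have := st2 t0; have := G0 (c + p2 * (t0 - c)); move: (G _) => x x0 E; nra.
have Gc : G c = 0.
  have := st2 c; rewrite subrr mulr0 addr0 => E.
  have := ndG _ _ (ltW ct0); move: E; move: (G c) => x E xt.
  have : x * (x - 1) = 0 by lra.
  by move/eqP; rewrite mulf_eq0 => /orP[] /eqP; lra.
have Gle t : t <= c -> G t = 0.
  by move=> /ndG; rewrite Gc => H; apply/eqP; rewrite eq_le H G0.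
have Ggt t : c < t -> 0 < G t < 1.
  move=> ct; apply/andP; split.
    have [m /ndG H] := escape t0 t ct; rewrite -(iter m) exprn_gt0//.
    exact: lt_le_trans H.
  have [m /ndG] := escape t t0 ct0; move=> /le_lt_trans; apply.
  rewrite ltNge; apply/negP => H.
  have {}H : G (c + p2 ^+ m * (t0 - c)) = 1 by apply/eqP; rewrite eq_le G1 H.
  by move: g1; rewrite -(iter m t0) H expr1n ltxx.
have stc k : (0 < k)%N ->
    exists2 p, 0 < p & forall t, G (c + p * t) ^+ k = G (c + t).
  move=> k0; have [p [q [p0 pq]]] := st k k0.
  (* Each affine map preserves the zero set of G, which is the half-line up to [c], and therefore
     fixes its endpoint. *)
  suff fc : p * c + q = c.
    exists p => // t; rewrite -(pq (c + t)); congr (G _ ^+ _).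
    by rewrite -[in LHS]fc; ring.
  apply/eqP; rewrite eq_le; apply/andP; split; rewrite leNgt; apply/negP => H.
    have /andP[+ _] := Ggt _ H; rewrite lt0r => /andP[/negP + _]; apply.
    by have := pq c; rewrite Gc => /eqP; rewrite expf_eq0 => /andP[].
  have ct : c < c + (c - (p * c + q)) / p by rewrite ltrDl divr_gt0// subr_gt0.
  have /andP[+ _] := Ggt _ ct; rewrite -(pq (c + _)).
  have -> : p * (c + (c - (p * c + q)) / p) + q = c by field; rewrite gt_eqF.
  by rewrite Gc expr0n gtn_eqF// ltxx.
pose H t := - ln (G (c + t)).
have HE t : 0 < t -> G (c + t) = expR (- H t).
  move=> t0'; rewrite /H opprK lnK// posrE.
  by have /andP[] : 0 < G (c + t) < 1 by apply: Ggt; rewrite ltrDl.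
have [||k k0|a [h [a0 h0 hH]]] := @power_law_of_scaling R H.
- move=> t tp; rewrite /H oppr_gt0 ln_lt0// Ggt// ltrDl//.
- move=> s t s0 st'; rewrite /H lerN2 ler_ln ?posrE.
  + by apply: ndG; rewrite lerD2l.
  + by have /andP[] : 0 < G (c + s) < 1 by apply: Ggt; rewrite ltrDl.
  + have /andP[]// : 0 < G (c + t) < 1.
    by apply: Ggt; rewrite ltrDl (lt_le_trans s0).
- have [p p0 pk] := stc k k0; exists p => // t tp.
  have kn0 : k%:R != 0 :> R by rewrite pnatr_eq0 -lt0n.
  rewrite /H -(pk t) lnXn; last first.
    have /andP[]// : 0 < G (c + p * t) < 1.
    by apply: Ggt; rewrite ltrDl mulr_gt0.
  by rewrite -mulr_natr mulNr; field.
have GE t : 0 < t -> G (c + t) = expR (- (h * t `^ (- a))).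
  by move=> tp; rewrite HE// hH.
have ale1 := tail_exponent_le1 mG a0 h0 GE.
have ha0 : 0 < h `^ a^-1 by rewrite powR_gt0.
(* Scaling by h^(1/a) absorbs the constant: (t / h^(1/a))^(-a) = h t^(-a). *)
exists (h `^ a^-1), c, a; rewrite ha0 a0 ale1; do 2!split => //.
move=> x; rewrite /frechet pmulr_lgt0 ?invr_gt0// subr_gt0.
case: ltP => cx; last exact: Gle.
have tp : 0 < x - c by rewrite subr_gt0.
have := GE _ tp; rewrite addrC subrK => ->; congr (expR (- _)).
rewrite powRM ?invr_ge0 ?ltW// mulrC; congr (_ * _).
rewrite -powR_inv1 ?ltW// -!powRrM.
rewrite [X in _ `^ X](_ : _ = 1) ?powRr1 ?ltW//.
by field; rewrite gt_eqF.
Qed.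

Lemma frechet_of_max_stable (R : realType) (G : R -> R) (t0 : R) :
  is_df G -> 0 < G t0 < 1 -> midpoint_bound G ->
  (forall k, (0 < k)%N -> exists p q, 0 < p /\ forall t, G (p * t + q) ^+ k = G t) ->
  exists a b alpha : R, 0 < a /\ 0 < alpha <= 1 /\
    forall x, G x = frechet alpha ((x - b) / a).
Proof.
move=> dfG g01 mG st; have [p [q [p0 pq]]] := st 2%N isT.
have [pE|pN1] := eqVneq p 1.
  case: (@not_translation_stable R G q t0) => // t.
  by rewrite -(pq t) pE mul1r.
(* For [p != 1], the point [q / (1 - p)] is the fixed point of the affine map, which becomes a
   dilation about it. *)
have dil t : G (q / (1 - p) + p * (t - q / (1 - p))) ^+ 2 = G t.
  rewrite -(pq t); congr (G _ ^+ _); field.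
  by rewrite subr_eq0 eq_sym.
have [p1|p1|pE] := ltgtP p 1; last by rewrite pE eqxx in pN1.
- have p01 : 0 < p < 1 by rewrite p0 p1.
  by case: (@not_contraction_stable R G (q / (1 - p)) p t0 dfG g01 mG p01 dil).
- exact: (@frechet_of_dilation_stable R G (q / (1 - p)) p t0).
Qed.

(** * Convergence of types *)

Lemma is_df_exp (R : realType) (G : R -> R) (k : nat) :
  is_df G -> (0 < k)%N -> is_df (fun t => G t ^+ k).
Proof.
move=> [G01 ndG rcG Glo Ghi] k0.
have G0 x : 0 <= G x by case/andP: (G01 x).
have G1 x : G x <= 1 by case/andP: (G01 x).
have kn0 : k%:R != 0 :> R by rewrite pnatr_eq0 -lt0n.
have rootK (c : R) : 0 < c -> (c `^ k%:R^-1) ^+ k = c.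
  by move=> c0; rewrite -powR_mulrn ?powR_ge0// -powRrM mulVf// powRr1// ltW.
split.
- by move=> x; rewrite exprn_ge0// exprn_ile1.
- by move=> x y xy; rewrite lerXn2r ?nnegrE// ndG.
- move=> x c H; have [c0|c0] := leP c 0; first exact: le_trans (exprn_ge0 _ _).
  rewrite -(rootK c c0) ler_pXn2r ?nnegrE ?powR_ge0//; apply: rcG => y /H.
  by rewrite -[leLHS](rootK c c0) ler_pXn2r ?nnegrE ?powR_ge0.
- move=> e /Glo[x xe]; exists x; apply: le_lt_trans xe.
  by rewrite ler_iXnr// -lt0n.
- move=> e e1; have [e0|e0] := ltP 0 e.
    have /Ghi[x xe] : e `^ k%:R^-1 < 1.
      by rewrite -(@ltr_pXn2r _ k) ?nnegrE ?powR_ge0// rootK// expr1n.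
    by exists x; rewrite -[ltLHS](rootK _ e0) ltr_pXn2r ?nnegrE ?powR_ge0.
  have [x xe] := Ghi 0 ltr01; exists x.
  by apply: le_lt_trans e0 _; rewrite exprn_gt0.
Qed.

Lemma ultra_fmap (T U : Type) (f : T -> U) (F : set_system T) :
  UltraFilter F -> UltraFilter (f @ F).
Proof.
move=> UF; split=> [|G PG sG]; first exact: fmap_proper_filter.
apply/seteqP; split=> // A GA.
have [//|FnA] := in_ultra_setVsetC (f @^-1` A) UF.
have : G (A `&` ~` A) by apply: filterI => //; exact: sG.
by rewrite setICr => /filter_not_empty.
Qed.

(* The images of two points under [t |-> p n * t + q n] stay in a compact
   interval, so they converge along an ultrafilter finer than [\oo]; the limits
   determine [p'] and [q']. *)
Lemma convergence_of_types (R : realType) (D : set R) (G1 G2 : R -> R)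
    (t1 t2 : R) (Phi : nat -> R -> R) (p q : nat -> R) :
  (forall a b, a < b -> exists2 c, a < c < b & D c) ->
  is_df G1 -> is_df G2 -> 0 < G1 t1 < 1 -> 0 < G2 t2 < 1 ->
  (forall n, {homo Phi n : x y / x <= y}) -> (forall n, 0 < p n) ->
  (forall t, D t -> Phi n t @[n --> \oo] --> G1 t) ->
  (forall t, D t -> Phi n (p n * t + q n) @[n --> \oo] --> G2 t) ->
  exists p' q', 0 < p' /\ forall t, G1 (p' * t + q') = G2 t.
Proof.
move=> dD [G101 ndG1 rcG1 G1lo G1hi] [G201 ndG2 rcG2 G2lo G2hi].
move=> /andP[a0 a1] /andP[b0 b1] ndPhi p0 cv1 cv2.
have [s1 [s2 [s12 [D1 D2] [v1 v2]]]] : exists s1 s2,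
    [/\ s1 < s2, D s1 /\ D s2 & 0 < G2 s1 /\ G2 s2 < 1].
  have [y ty y1] : exists2 y, t2 < y & G2 y < 1.
    apply: contrapT => H; move: b1; rewrite ltNge => /negP; apply; apply: rcG2.
    by move=> y ty; rewrite leNgt; apply/negP => y1; apply: H; exists y.
  have [s1 /andP[l1 u1] D1] := dD _ _ ty.
  have [s2 /andP[l2 u2] D2] := dD _ _ u1.
  exists s1, s2; split => //; split.
    by apply: lt_le_trans b0 _; exact/ndG2/ltW.
  by apply: le_lt_trans y1; exact/ndG2/ltW.
(* The points [l] and [r] eventually trap the images of [s1] and [s2]: the strict inequalities
   between limit values pass to [Phi n], which is monotone. *)
have [l Dl lv] : exists2 l, D l & G1 l < G2 s1.
  have [x xP] := G1lo _ v1.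
  have [l /andP[_ lx] Dl] := dD (x - 1) x ltac:(lra).
  by exists l => //; apply: le_lt_trans xP; exact/ndG1/ltW.
have [r Dr rv] : exists2 r, D r & G2 s2 < G1 r.
  have [x xP] := G1hi _ v2.
  have [r /andP[rx _] Dr] := dD x (x + 1) ltac:(lra).
  by exists r => //; apply: lt_le_trans xP _; exact/ndG1/ltW.
pose x n := p n * s1 + q n; pose y n := p n * s2 + q n.
have xy n : x n < y n by rewrite ltrD2r ltr_pM2l.
have lt_of_lim u v w1 w2 (g1 g2 : R) : g1 < g2 ->
    Phi n (u n) @[n --> \oo] --> g1 -> Phi n (v n) @[n --> \oo] --> g2 ->
    u = w1 -> v = w2 -> \forall n \near \oo, w1 n < w2 n.
  move=> g12 c1 c2 <- <-.
  have m1 : g1 < (g1 + g2) / 2 by lra.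
  have m2 : (g1 + g2) / 2 < g2 by lra.
  near=> n; rewrite ltNge; apply/negP => /(ndPhi n); apply/negP; rewrite -ltNge.
  apply: (@lt_trans _ _ ((g1 + g2) / 2)).
    by near: n; exact: (cvgr_lt _ c1).
  by near: n; exact: (cvgr_gt _ c2).
have lx : \forall n \near \oo, l < x n.
  exact: (lt_of_lim _ _ (fun=> l) x _ _ lv (cv1 _ Dl) (cv2 _ D1)).
have yr : \forall n \near \oo, y n < r.
  exact: (lt_of_lim _ _ y (fun=> r) _ _ rv (cv2 _ D2) (cv1 _ Dr)).
have [F [UF sF]] := ultraFilterLemma (@eventually_filter).
have lim_of z : (\forall n \near \oo, l <= z n <= r) -> exists Z : R, z @ F --> Z.
  move=> zb; have := @segment_compact R l r; rewrite compact_ultra.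
  move=> /(_ (z @ F) (ultra_fmap z UF))[|Z [_ ZF]]; last by exists Z.
  by apply: sF; apply: filterS zb => n; rewrite /= in_itv.
have [A xA] : exists A : R, x @ F --> A.
  apply: lim_of; near=> n; apply/andP; split.
    by apply: ltW; near: n.
  by apply: ltW; apply: lt_trans (xy n) _; near: n.
have [B yB] : exists B : R, y @ F --> B.
  apply: lim_of; near=> n; apply/andP; split; last by apply: ltW; near: n.
  by apply: ltW; apply: lt_trans (xy n); near: n.
have AB : A <= B.
  by apply: ler_cvg_to xA yB _; near=> n; exact/ltW/xy.
have d0 : 0 < s2 - s1 by rewrite subr_gt0.
(* The limiting affine map sends [s1] to [A] and [s2] to [B]. *)
pose p' := (B - A) / (s2 - s1); pose q' := A - p' * s1.
have cvpq t : p n * t + q n @[n --> F] --> p' * t + q'.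
  have -> : (fun n => p n * t + q n) =
      (fun n => x n + (y n - x n) * ((t - s1) / (s2 - s1))).
    by apply/funext => n; rewrite /x /y; field; rewrite gt_eqF.
  have -> : p' * t + q' = A + (B - A) * ((t - s1) / (s2 - s1)).
    by rewrite /q' /p'; field; rewrite gt_eqF.
  by apply: cvgD => //; apply: cvgM; [exact: cvgB|exact: cvg_cst].
have F1 t : D t -> Phi n t @[n --> F] --> G1 t.
  by move=> Dt; apply: cvg_trans (cv1 t Dt); exact: cvg_app.
have F2 t : D t -> Phi n (p n * t + q n) @[n --> F] --> G2 t.
  by move=> Dt; apply: cvg_trans (cv2 t Dt); exact: cvg_app.
have lower u s : D u -> D s -> u < p' * s + q' -> G1 u <= G2 s.
  move=> Du Ds us; apply: ler_cvg_to (F1 _ Du) (F2 _ Ds) _.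
  by near=> n; apply/ndPhi/ltW; near: n; exact: (cvgr_gt _ (cvpq s)).
have upper u s : D u -> D s -> p' * s + q' < u -> G2 s <= G1 u.
  move=> Du Ds us; apply: ler_cvg_to (F2 _ Ds) (F1 _ Du) _.
  by near=> n; apply/ndPhi/ltW; near: n; exact: (cvgr_lt _ (cvpq s)).
(* If [p' = 0], every image tends to [q']. For [t1 < q'], letting [s] go to minus infinity gives
   [G1 t1 = 0]; otherwise letting [s] go to plus infinity gives [G1 t1 = 1]. *)
have p'0 : 0 < p'.
  have p'ge : 0 <= p' by apply: divr_ge0; [rewrite subr_ge0|exact: ltW].
  rewrite lt0r p'ge andbT; apply/negP => /eqP pE.
  have [qt|tq] := ltP t1 q'.
    have [u /andP[tu uq] Du] := dD _ _ qt.
    have [z zP] := G2lo _ a0.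
    have [s /andP[_ sz] Ds] := dD (z - 1) z ltac:(lra).
    have H := lower u s Du Ds; rewrite pE mul0r add0r in H.
    have := le_trans (ndG1 _ _ (ltW tu)) (H uq).
    by move/le_trans => /(_ _ (ndG2 _ _ (ltW sz))); rewrite leNgt zP.
  have [z zP] := G2hi _ a1.
  have [s /andP[zs _] Ds] := dD z (z + 1) ltac:(lra).
  have : G2 s <= G1 t1.
    apply: rcG1 => w tw; have [u /andP[tu uw] Du] := dD _ _ tw.
    apply: le_trans (upper u s Du Ds _) (ndG1 _ _ (ltW uw)).
    by rewrite pE mul0r add0r; exact: le_lt_trans tu.
  by move/(le_trans (ndG2 _ _ (ltW zs))); rewrite leNgt zP.
(* [lower] and [upper] compare only points of [D]; density of [D] and right-continuity of G2,
   respectively G1, extend both inequalities to all [t]. *)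
exists p', q'; split => // t; apply/eqP; rewrite eq_le; apply/andP; split.
  apply: rcG2 => w tw; have [s /andP[ts sw] Ds] := dD _ _ tw.
  have : p' * t + q' < p' * s + q' by rewrite ltrD2r ltr_pM2l.
  move=> /dD[u /andP[tu us] Du].
  apply: le_trans (ndG1 _ _ (ltW tu)) _.
  exact: le_trans (lower u s Du Ds us) (ndG2 _ _ (ltW sw)).
apply: rcG1 => w tw; have [u /andP[tu uw] Du] := dD _ _ tw.
have : t < (u - q') / p' by rewrite ltr_pdivlMr//; lra.
move=> /dD[s /andP[ts su] Ds].
apply: le_trans (ndG2 _ _ (ltW ts)) _.
apply: le_trans (upper u s Du Ds _) (ndG1 _ _ (ltW uw)).
by move: su; rewrite ltr_pdivlMr//; lra.
Unshelve. all: by end_near. Qed.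

(** * Maxima of i.i.d. sequences *)

Lemma distfunE (R : realType) (d : measure_display) (T : measurableType d)
    (P : probability T R) (Z : T -> R) (t : R) : measurable_fun setT Z ->
  P (Z @^-1` `]-oo, t]) = (distfun P Z t)%:E.
Proof.
move=> mZ; have -> : Z @^-1` `]-oo, t] = [set w | Z w <= t].
  by apply/seteqP; split => w; rewrite /= in_itv.
by rewrite /distfun fineK// fin_num_measure// -[X in measurable X]setTI;
  exact: measurable_fun_le.
Qed.

Lemma measurable_weighted_sum (R : realType) (d : measure_display)
    (T : measurableType d) (n : nat) (theta : 'I_n -> R) (X : 'I_n -> T -> R) :
  (forall i, measurable_fun setT (X i)) ->
  measurable_fun setT (fun w => \sum_(i < n) theta i * X i w).
Proof.
move=> mX; apply: measurable_sum => i.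
exact: (measurableT_comp (mulrl_measurable (theta i)) (mX i)).
Qed.

(** The maximum runs over [n.+1] variables, hence the exponent; its starting value [X 0%N] is one of
    them and adds no constraint. *)
Lemma distfun_max_first (R : realType) (d : measure_display)
    (T : measurableType d) (P : probability T R) (X : nat -> T -> R)
    (a b t : R) (n : nat) : iid_seq P X -> 0 < a ->
  distfun P (fun w => a * max_first X n w - b) t =
  distfun P (X 0%N) ((t + b) / a) ^+ n.+1.
Proof.
move=> [mX [indX dX]] a0; apply: EFin_inj.
have -> : (distfun P (fun w => a * max_first X n w - b) t)%:E =
    P (\bigcap_(i in [set: 'I_n.+1]) (X (val i) @^-1` `]-oo, (t + b) / a])).
  rewrite /distfun.
  have -> : [set w | a * max_first X n w - b <= t] =
      \bigcap_(i in [set: 'I_n.+1]) (X (val i) @^-1` `]-oo, (t + b) / a]).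
    apply/seteqP; split => w /=.
      rewrite lerBlDr mulrC -ler_pdivlMr// => /bigmax_leP[_ H] i _ /=.
      by rewrite in_itv/=; exact: H.
    move=> H; rewrite lerBlDr mulrC -ler_pdivlMr//; apply/bigmax_leP; split.
      by have := H ord0 I; rewrite /= in_itv.
    by move=> i _; have := H i I; rewrite /= in_itv.
  rewrite fineK// fin_num_measure//; apply: fin_bigcap_measurable => // i _.
  by rewrite -[X in measurable X]setTI; exact: mX.
rewrite (indX n.+1 (fun=> `]-oo, (t + b) / a]%classic))//.
rewrite (eq_bigr (fun=> (distfun P (X 0%N) ((t + b) / a))%:E)).
  by rewrite prodEFin prodr_const card_ord.
by move=> i _; rewrite distfunE// dX.
Qed.

Lemma max_stable_affine (R : realType) (d : measure_display)
    (T : measurableType d) (P : probability T R) (Z : T -> R) (k : nat) :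
  max_stable P Z -> (0 < k)%N ->
  exists p q, 0 < p /\ forall t, distfun P Z (p * t + q) ^+ k = distfun P Z t.
Proof.
move=> [mZ [nd [d' [T' [P' [X [a [b [iidX [a0 cv]]]]]]]]]] k0.
have [t0 t01] := nondegenerate_value mZ nd.
have dfZ := distfun_is_df P mZ.
set G := distfun P Z in t01 dfZ *; set F := distfun P' (X 0%N).
have dfF : is_df F by apply: distfun_is_df; case: iidX.
have [F01 ndF _ _ _] := dfF.
have F0 x : 0 <= F x by case/andP: (F01 x).
(* The index [m n] belongs to a maximum of exactly [k * n.+1] variables. Normalised by the constants
   of index [n] its law tends to [G ^+ k], and by those of index [m n] to G. *)
pose m n := (k * n.+1).-1.
have mS n : (m n).+1 = (k * n.+1)%N by rewrite prednK// muln_gt0 k0.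
have cvF t : {for t, continuous G} ->
    F ((t + b n) / a n) ^+ n.+1 @[n --> \oo] --> G t.
  have E : (fun n => distfun P' (fun w => a n * max_first X n w - b n) t) =
      (fun n => F ((t + b n) / a n) ^+ n.+1).
    by apply/funext => n; exact: distfun_max_first.
  by move=> /cv; rewrite E.
have moo : m n @[n --> \oo] --> \oo.
  move=> A [N _ NA]; exists N => // n /= Nn; apply: NA => /=.
  by rewrite -ltnS mS (leq_ltn_trans Nn)// leq_pmull.
pose Phi n t := F ((t + b n) / a n) ^+ (k * n.+1).
apply: (@convergence_of_types R [set t | {for t, continuous G}]
  (* The affine map converts one normalisation into the other: it sends [t] to the point whose image
     under [(_ + b n) / a n] is [(t + b (m n)) / a (m n)]. *)
  (fun t => G t ^+ k) G t0 t0 Phi (fun n => a n / a (m n))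
  (fun n => a n * b (m n) / a (m n) - b n)) => //.
- move=> x y xy; apply: continuity_point_dense xy.
  by case: dfZ.
- exact: is_df_exp.
- by case/andP: t01 => *; rewrite exprn_gt0//= exprn_ilt1 ?ltW// -lt0n.
- move=> n x y xy; rewrite /Phi lerXn2r ?nnegrE//; apply: ndF.
  by rewrite ler_pM2r ?invr_gt0// lerD2r.
- by move=> n; rewrite divr_gt0.
- move=> t ct; rewrite /Phi.
  under eq_fun do rewrite mulnC exprM.
  apply: (cvg_comp _ (fun x : R => x ^+ k) (cvF t ct)).
  exact: exprn_continuous.
- move=> t ct; have := cvg_comp _ _ moo (cvF t ct).
  rewrite [X in X @ _ --> _ -> _](_ : _ = fun n =>
    Phi n (a n / a (m n) * t + (a n * b (m n) / a (m n) - b n)))//.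
  apply/funext => n /=; rewrite /Phi mS; congr (F _ ^+ _).
  by field; rewrite !gt_eqF.
Qed.

(** * From membership in D^- to the midpoint inequality *)

Lemma midpoint_bound_of_Dminus (R : realType) (d : measure_display)
    (T : measurableType d) (P : probability T R) (Z : T -> R) :
  measurable_fun setT Z -> in_Dminus (distfun P Z) ->
  midpoint_bound (distfun P Z).
Proof.
move=> mZ DZ s v sv.
have mpre A : measurable A -> measurable (Z @^-1` A).
  by move=> mA; rewrite -[X in measurable X]setTI; exact: mZ.
(* The two coordinates of the product space carry independent copies of [Z]. *)
pose Q : probability (T * T)%type R := (P \x P)%E.
have QM A B : measurable A -> measurable B -> Q (A `*` B) = (P A * P B)%E.
  exact: product_measure1E.
pose X (i : 'I_2) (w : T * T) := if i == ord0 then Z w.1 else Z w.2.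
have mZ1 : measurable_fun setT (Z \o fst : T * T -> R).
  exact: measurableT_comp measurable_fst.
have mZ2 : measurable_fun setT (Z \o snd : T * T -> R).
  exact: measurableT_comp measurable_snd.
have mX i : measurable_fun setT (X i).
  by rewrite /X; case: (i == ord0).
have PX i A : measurable A -> Q (X i @^-1` A) = P (Z @^-1` A).
  move=> mA; rewrite /X; case: (i == ord0).
    have -> : (fun w : T * T => Z w.1) @^-1` A = (Z @^-1` A) `*` setT.
      by apply/seteqP; split => w //= [].
    rewrite QM//; last exact: mpre.
    by rewrite [X in (_ * X)%E](probability_setT P) mule1.
  have -> : (fun w : T * T => Z w.2) @^-1` A = setT `*` (Z @^-1` A).
    by apply/seteqP; split => w //= [].
  rewrite QM//; last exact: mpre.
  by rewrite [X in (X * _)%E](probability_setT P) mul1e.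
have iidX : iid_fin Q X (distfun P Z).
  split=> //; split=> [B mB|i].
    have -> : \bigcap_(i in [set: 'I_2]) (X i @^-1` B i) =
        (Z @^-1` B ord0) `*` (Z @^-1` B ord_max).
      apply/seteqP; split => [w H|w [H0 H1] i _].
        by split; [exact: (H ord0)|exact: (H ord_max)].
      have [->//|i0] := eqVneq i ord0.
      have -> : i = ord_max by apply/val_inj; case: i i0 => [[|[]]].
      exact: H1.
    rewrite QM; [|exact: mpre..].
    rewrite big_ord_recl big_ord1 !PX//; congr (_ * P (Z @^-1` (B _)))%E.
    exact/val_inj.
  apply/funext => t; apply: EFin_inj.
  by rewrite -!distfunE// PX.
have half : \sum_(i < 2) (2^-1 : R) = 1 by rewrite !big_ord_recl big_ord0; lra.
have half0 (i : 'I_2) : 0 <= (2^-1 : R) by rewrite invr_ge0.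
have := DZ 1%N (fun=> 2^-1) half0 half _ _ Q X iidX ((s + v) / 2).
have [_ [_ /(_ ord0) ->]] := iidX.
apply: le_trans; rewrite -lee_fin -distfunE; last first.
  exact: (measurable_weighted_sum (fun=> 2^-1) mX).
(* These disjoint rectangles lie in the event that the mean is at most [(s + v) / 2]; their
   probabilities G(s) G(v) and (G(v) - G(s)) G(s) add up to the bound. *)
pose E1 := (Z @^-1` `]-oo, s]) `*` (Z @^-1` `]-oo, v]).
pose E2 := (Z @^-1` `]s, v]) `*` (Z @^-1` `]-oo, s]).
have mE1 : measurable E1 by apply: measurableX; exact: mpre.
have mE2 : measurable E2 by apply: measurableX; exact: mpre.
have Psv : P (Z @^-1` `]s, v]) = (distfun P Z v - distfun P Z s)%:E.
  rewrite EFinB -!distfunE//.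
  have -> : Z @^-1` `]-oo, v] = Z @^-1` `]-oo, s] `|` Z @^-1` `]s, v].
    by rewrite -preimage_setU -itv_bndbnd_setU// bnd_simp.
  rewrite measureU; [|exact: mpre|exact: mpre|].
    by rewrite addeAC subee ?add0e// fin_num_measure//; exact: mpre.
  rewrite -preimage_setI; apply/seteqP; split => // w /=.
  by rewrite !in_itv/= => -[ws /andP[]]; rewrite ltNge ws.
have <- : Q (E1 `|` E2) =
    (distfun P Z s * (2 * distfun P Z v - distfun P Z s))%:E.
  rewrite measureU//; last first.
    apply/seteqP; split => // w [[/= + _] [/= + _]].
    by rewrite !in_itv/= => ws /andP[]; rewrite ltNge ws.
  transitivity (P (Z @^-1` `]-oo, s]) * P (Z @^-1` `]-oo, v]) +
      P (Z @^-1` `]s, v]) * P (Z @^-1` `]-oo, s]))%E.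
    by congr (_ + _)%E; apply: QM; exact: mpre.
  by rewrite !distfunE// Psv -!EFinM -EFinD; congr EFin; ring.
apply: le_measure; rewrite ?inE//; first exact: measurableU.
  rewrite -[X in measurable X]setTI.
  exact: (measurable_weighted_sum (fun=> 2^-1) mX).
move=> w H /=; rewrite in_itv/= !big_ord_recl big_ord0 /X/=.
case: H => -[] /=; rewrite !in_itv/=; clear -sv.
  by move: (Z w.1) (Z w.2) => x y xs yv; lra.
by move: (Z w.1) (Z w.2) => x y /andP[_ xv] ys; lra.
Qed.

(** * Fréchet laws belong to D^- *)

Lemma weighted_sum_center (R : realType) (n : nat) (theta x : 'I_n -> R) (b : R) :
  \sum_(i < n) theta i = 1 ->
  \sum_(i < n) theta i * x i = b + \sum_(i < n) theta i * (x i - b).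
Proof.
move=> t1; under [X in _ = _ + X]eq_bigr do rewrite mulrBr.
by rewrite sumrB -mulr_suml t1 mul1r addrC subrK.
Qed.

Lemma sum_gt_of_all_gt (R : realType) (n : nat) (theta x : 'I_n -> R) (b : R) :
  (forall i, 0 <= theta i) -> \sum_(i < n) theta i = 1 ->
  (forall i, b < x i) -> b < \sum_(i < n) theta i * x i.
Proof.
move=> t0 t1 xb; rewrite (weighted_sum_center _ b t1).
have ge0 i : 0 <= theta i * (x i - b) by rewrite mulr_ge0// subr_ge0 ltW.
rewrite ltrDl lt0r sumr_ge0// andbT psumr_eq0//; apply/negP => /allP H.
have := oner_neq0 R; rewrite -t1 big1 ?eqxx// => i _.
have := H i (mem_index_enum _); rewrite /= mulf_eq0 subr_eq0 => /orP[/eqP//|].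
by rewrite gt_eqF.
Qed.

Lemma frechet_Dminus (R : realType) (F : R -> R) (a b alpha : R) :
  0 < a -> 0 < alpha <= 1 -> (forall x, F x = frechet alpha ((x - b) / a)) ->
  in_Dminus F.
Proof.
move=> a0 /andP[al0 al1] FE n theta th0 th1 d T P X [mX [indX dX]] t.
have FEgt x : b < x -> F x = expR (- ((x - b) / a) `^ (- alpha)).
  by move=> bx; rewrite FE /frechet divr_gt0// subr_gt0.
have Fb : F b = 0 by rewrite FE /frechet subrr mul0r ltxx.
have mpre i A : measurable A -> measurable (X i @^-1` A).
  by move=> mA; rewrite -[X in measurable X]setTI; exact: mX.
(* Off this null event all [X i - b] are positive, so a bound on their weighted sum bounds every
   single term. *)
pose N := ~` \bigcap_(i in [set: 'I_n.+1]) (X i @^-1` `]b, +oo[).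
have mcap B : (forall i, measurable (B i)) ->
    measurable (\bigcap_(i in [set: 'I_n.+1]) (X i @^-1` B i)).
  by move=> mB; apply: fin_bigcap_measurable => // i _; exact: mpre.
have N0 : P N = 0.
  rewrite probability_setC; last exact: mcap.
  rewrite (indX (fun=> `]b, +oo[%classic))// big1 ?subee// => i _.
  have -> : X i @^-1` `]b, +oo[ = ~` (X i @^-1` `]-oo, b]).
    by rewrite preimage_setC setCitvl.
  rewrite probability_setC; last exact: mpre.
  by rewrite distfunE// dX Fb sube0.
have mN : measurable N by apply: measurableC; exact: mcap.
set S := fun w => \sum_(i < n.+1) theta i * X i w.
have mS : measurable_fun setT S by exact: measurable_weighted_sum.
rewrite dX -lee_fin -distfunE//.
have mSt : measurable (S @^-1` `]-oo, t]).
  by rewrite -[X in measurable X]setTI; exact: mS.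
have dominated M : measurable M -> S @^-1` `]-oo, t] `<=` M `|` N ->
    (P (S @^-1` `]-oo, t]) <= P M)%E.
  move=> mM sub; rewrite -(measureU0 mM mN N0).
  by apply: le_measure; rewrite ?inE//; exact: measurableU.
have notN w : ~ N w -> forall i, b < X i w.
  by move/contrapT => H i; have := H i I; rewrite /= in_itv/= andbT.
have [tb|bt] := leP t b.
  have Ft0 : 0 <= F t.
    by rewrite FE /frechet; case: ifP => // _; exact: expR_ge0.
  apply: le_trans (dominated set0 measurable0 _) _; last by rewrite measure0 lee_fin.
  move=> w; rewrite /= in_itv/= => Sw; right; apply: contrapT => /notN bX.
  have := sum_gt_of_all_gt th0 th1 bX.
  by rewrite ltNge (le_trans Sw tb).
pose s := (t - b) / a.
have s0 : 0 < s by rewrite divr_gt0// subr_gt0.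
pose B i := [set x : R | theta i * (x - b) <= t - b].
have PB i : measurable (B i) /\
    P (X i @^-1` B i) = (expR (- (theta i `^ alpha * s `^ (- alpha))))%:E.
  (* A zero weight imposes no constraint, which agrees with the formula because [0] to the positive
     power [alpha] is [0]. *)
  have [ti|ti] := eqVneq (theta i) 0.
    have -> : B i = setT.
      by apply/seteqP; split => // x _; rewrite /B/= ti mul0r subr_ge0 ltW.
    split=> //; rewrite preimage_setT probability_setT ti powR0 ?gt_eqF//.
    by rewrite mul0r oppr0 expR0.
  have tip : 0 < theta i by rewrite lt0r ti th0.
  have -> : B i = `]-oo, b + (t - b) / theta i]%classic.
    have E x : (theta i * (x - b) <= t - b) = (x <= b + (t - b) / theta i).
      by rewrite -[RHS]lerBlDl ler_pdivlMr// mulrC.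
    by apply/seteqP; split => x; rewrite /B /= in_itv/= E.
  split=> //; rewrite distfunE// dX FEgt; last first.
    by rewrite ltrDl divr_gt0// subr_gt0.
  rewrite addrC addKr; congr (expR (- _))%:E.
  have -> : (t - b) / theta i / a = (theta i)^-1 * s by rewrite /s; ring.
  rewrite powRM ?invr_ge0 ?ltW//; congr (_ * _).
  by rewrite -powR_inv1 ?ltW// -powRrM mulN1r opprK.
have mB i : measurable (B i) by have [] := PB i.
apply: le_trans (dominated _ (mcap B mB) _) _.
  move=> w; rewrite /= in_itv/= => Sw.
  have [Nw|/notN bX] := pselect (N w); [by right|left] => i _ /=; rewrite /B/=.
  have : \sum_(j < n.+1) theta j * (X j w - b) <= t - b.
    by rewrite lerBrDl -(weighted_sum_center _ b th1).
  apply: le_trans; rewrite (bigD1 i)//= lerDl sumr_ge0// => j _.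
  by rewrite mulr_ge0// subr_ge0 ltW.
rewrite indX//; under eq_bigr do rewrite (PB _).2.
rewrite prodEFin -expR_sum lee_fin FEgt// ler_expR sumrN lerN2 -mulr_suml -/s.
apply: ler_peMl; first exact: powR_ge0.
(* Each weight is in [0, 1] and [alpha <= 1], so theta_i^alpha >= theta_i and the sum of these
   powers is at least 1. *)
rewrite -th1; apply: ler_sum => i _.
have [->|ti] := eqVneq (theta i) 0; first exact: powR_ge0.
apply: ger1_powR => //; rewrite lt0r ti th0 -th1 (bigD1 i)//= lerDl.
by rewrite sumr_ge0.
Qed.

Theorem theorem5 (R : realType) (d : measure_display) (T : measurableType d)
  (P : probability T R) (Z : T -> R) :
  max_stable P Z ->
  (in_Dminus (distfun P Z) <->
   exists (a b alpha : R), 0 < a /\ 0 < alpha <= 1 /\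
     forall x : R, distfun P Z x = frechet alpha ((x - b) / a)).
Proof.
move=> msZ; have [mZ [nd _]] := msZ; split=> [DZ|[a [b [alpha [a0 [al H]]]]]].
  have [t0 t01] := nondegenerate_value mZ nd.
  apply: (frechet_of_max_stable (distfun_is_df P mZ) t01).
    exact: midpoint_bound_of_Dminus.
  by move=> k; exact: max_stable_affine.
exact: frechet_Dminus a0 al H.
Qed.
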